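(* There exist an infinite set $\mathcal{I}$ of even positive integers, a sequence $\{C_n\}_{n\in\mathcal{I}}$ where $C_n$ is a real symmetric positive-semidefinite matrix of order $n$, and a positive scalar $b\ge 0.024036$ (independent of $n$) such that for all $n\in\mathcal{I}$ $$\min_{\gamma>0}\operatorname{linx}\left(C_n,\tfrac{n}{2};\gamma\right)-\min_{\bar\gamma>0}\operatorname{linx}\left(C_n,\tfrac{n}{2};I_n,\bar\gamma\right)\ \ge\ b\,n.$$
   Context: Notation: $\mathbf{e}$ is the all-ones vector in $\mathbb{R}^n$; $\operatorname{Diag}(x)$ is the diagonal matrix with diagonal $x$; $\circ$ is the Hadamard (entrywise) product; $I_n$ is the identity matrix of order $n$; $\operatorname{ldet}$ is the natural logarithm of the determinant (with value $-\infty$ if the determinant is $0$). For integers $0<s<n$, $P(n,s):=\{x\in\mathbb{R}^n:\mathbf{e}^\top x=s,\ 0\le x\le\mathbf{e}\}$. For a real symmetric positive-semidefinite matrix $C$ of order $n$ and $\gamma>0$, the scaled linx bound is $$\operatorname{linx}(C,s;\gamma):=\max\left\{\tfrac12\Big(\operatorname{ldet}\big(\gamma C\operatorname{Diag}(x)C+\operatorname{Diag}(\mathbf{e}-x)\big)-s\log\gamma\Big): x\in P(n,s)\right\}.$$ For a mask $M$ (a real symmetric positive-semidefinite matrix of order $n$ with all diagonal entries equal to $1$), the scaled and masked linx bound is $\operatorname{linx}(C,s;M,\gamma):=\operatorname{linx}(C\circ M,s;\gamma)$. *)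

(* Defs.v *)
From HB Require Import structures.
From mathcomp Require Export all_boot all_order all_algebra.
From mathcomp Require Export all_classical all_reals all_analysis.
Export Order.TTheory GRing.Theory Num.Theory.
Export numFieldNormedType.Exports.

Set Implicit Arguments.
Unset Strict Implicit.
Unset Printing Implicit Defensive.

Local Open Scope classical_set_scope.
Local Open Scope ring_scope.

Definition is_min {R : realType} (A : set (\bar R)) (m : \bar R) : Prop :=
  A m /\ lbound A m.

Definition psdmx {R : realType} {n : nat} (C : 'M[R]_n) : Prop :=
  C^T = C /\ forall v : 'cV[R]_n, 0 <= (v^T *m C *m v) 0 0.

(* [lne] is the logarithm with values in \bar R; it is -oo on reals <= 0. *)
Definition ldet {R : realType} {n : nat} (A : 'M[R]_n) : \bar R :=
  lne (\det A)%:E.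

Definition Pset {R : realType} (n s : nat) : set 'rV[R]_n :=
  [set x | \sum_(i < n) x 0 i = s%:R /\ forall i, 0 <= x 0 i <= 1].
Arguments Pset {R} n s _.

Definition linx_mx {R : realType} {n : nat} (C : 'M[R]_n) (g : R)
    (x : 'rV[R]_n) : 'M[R]_n :=
  g *: (C *m diag_mx x *m C) + diag_mx (const_mx 1 - x).

Definition linx_obj {R : realType} {n : nat} (C : 'M[R]_n) (s : nat) (g : R)
    (x : 'rV[R]_n) : \bar R :=
  ((2^-1)%:E * (ldet (linx_mx C g x) - (s%:R * ln g)%:E))%E.

(* The supremum is attained, see [linx_max] below. *)
Definition linx {R : realType} {n : nat} (C : 'M[R]_n) (s : nat) (g : R) :
    \bar R :=
  ereal_sup [set linx_obj C s g x | x in Pset n s].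

Definition hadamard {R : realType} {n : nat} (A B : 'M[R]_n) : 'M[R]_n :=
  map2_mx *%R A B.

Definition linx_masked {R : realType} {n : nat} (C : 'M[R]_n) (s : nat)
    (M : 'M[R]_n) (g : R) : \bar R :=
  linx (hadamard C M) s g.

Lemma Pset_neq0 (R : realType) (n s : nat) :
  (0 < s < n)%N -> @Pset R n s !=set0.
Proof.
case/andP=> s0 sn; have n0 : (0 < n)%N by apply: leq_trans sn.
have n0R : 0 < n%:R :> R by rewrite ltr0n.
exists (const_mx (s%:R / n%:R)); split=> [|i].
  under eq_bigr do rewrite mxE.
  by rewrite sumr_const card_ord -[LHS]mulr_natr mulfVK // gt_eqF.
by rewrite mxE divr_ge0 //= ler_pdivrMr // mul1r ler_nat ltnW.
Qed.

Lemma Pset_compact (R : realType) (n s : nat) : compact (@Pset R n s).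
Proof.
have cB : compact [set v : 'rV[R]_n | forall i, (`[0, 1]%classic : set R) (v ord0 i)].
  by apply: (@rV_compact R n (fun=> `[0, 1]%classic)) => _; exact: segment_compact.
have cS : continuous (fun v : 'rV[R]_n => \sum_(i < n) v 0 i).
  apply: (@continuous_big R _ _ _ _ _ 'rV[R]_n) => [|i _].
    exact: add_continuous.
  exact: coord_continuous.
have -> : @Pset R n s =
    [set v : 'rV[R]_n | forall i, (`[0, 1]%classic : set R) (v ord0 i)]
    `&` (fun v : 'rV[R]_n => \sum_(i < n) v 0 i) @^-1` [set y | y = s%:R].
  by apply/seteqP; split=> v /= [A B]; split=> // i.
apply: compact_closedI => //.
by apply: preimage_closed => [v _|]; [exact: cS|exact: closed_eq].
Qed.

Lemma linx_det_continuous (R : realType) (n : nat) (C : 'M[R]_n) (g : R) :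
  continuous (fun x : 'rV[R]_n => \det (linx_mx C g x)).
Proof.
have cE i j : continuous (fun x : 'rV[R]_n => linx_mx C g x i j).
  have -> : (fun x : 'rV[R]_n => linx_mx C g x i j) =
      (fun x => g * (\sum_(k < n) C i k * x 0 k * C k j)
                + (1 - x 0 i) * (i == j)%:R).
    apply/funext=> x; rewrite !mxE mulr_natr; congr (_ * _ + _).
    by apply: eq_bigr => k _; rewrite mul_mx_diag mxE.
  have cS : continuous (fun x : 'rV[R]_n => \sum_(k < n) C i k * x 0 k * C k j).
    apply: (@continuous_big R _ _ _ _ _ 'rV[R]_n) => [|k _].
      exact: add_continuous.
    move=> x; apply: (@cvgM _ _ (nbhs x)); last exact: cvg_cst.
    by apply: (@cvgM _ _ (nbhs x)); [exact: cvg_cst|exact: coord_continuous].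
  move=> x; apply: (@cvgD _ _ _ (nbhs x)); apply: (@cvgM _ _ (nbhs x)).
  - exact: cvg_cst.
  - exact: cS.
  - by apply: (@cvgB _ _ _ (nbhs x)); [exact: cvg_cst|exact: coord_continuous].
  - exact: cvg_cst.
apply: (@continuous_big R _ _ _ _ _ 'rV[R]_n) => [|p _].
  exact: add_continuous.
move=> x; apply: (@cvgM _ _ (nbhs x)); first exact: cvg_cst.
apply: (@continuous_big R _ _ _ _ _ 'rV[R]_n) => [|i _]; last exact: cE.
exact: mul_continuous.
Qed.

Lemma lne_homo (R : realType) : {homo @lne R : x y / (x <= y)%E}.
Proof.
move=> x y xy; have [x0|x0] := leP x 0%E; first by rewrite le0_lneNy // leNye.
by rewrite lee_lne // in_itv /= leey andbT ltW // (lt_le_trans x0).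
Qed.

Lemma linx_max (R : realType) (n s : nat) (C : 'M[R]_n) (g : R) :
  (0 < s < n)%N ->
  exists2 x, Pset n s x &
    linx C s g = linx_obj C s g x /\
    forall y, Pset n s y -> (linx_obj C s g y <= linx_obj C s g x)%E.
Proof.
move=> sn.
have [x] := @EVT_max_rV R n (fun x => \det (linx_mx C g x)) (Pset n s)
  (Pset_neq0 R sn) (@Pset_compact R n s)
  (continuous_subspaceT (@linx_det_continuous R n C g)).
rewrite inE => Px xmax; exists x => //.
have le_x y : Pset n s y -> (linx_obj C s g y <= linx_obj C s g x)%E.
  move=> Py; apply: lee_wpmul2l; first by rewrite lee_fin invr_ge0.
  by apply: leeD2r; apply: lne_homo; rewrite lee_fin xmax // inE.
split=> //; apply/eqP; rewrite eq_le; apply/andP; split.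
  by apply: ge_ereal_sup => _ [y Py <-]; exact: le_x.
by apply: ereal_sup_ubound; exists x.
Qed.

(* Main.v *)
Require Import Defs.
From mathcomp Require Import all_boot all_order all_algebra.
From mathcomp Require Import all_classical all_reals all_analysis.
From mathcomp Require Import ring lra zify.

(** The variables are split into [m = n / 3] triples and each triple is
    centred: with [W] the [m * n] incidence matrix of the triples,
    [C = 3/2 * P], where [P = I - W^T W / 3] is the orthogonal projection of
    rank [2 n / 3] that removes the mean of every triple.  The factor [3/2]
    makes the diagonal of [C] equal to 1, so masking by [I] turns [C] into [I].

    In both problems the objective has an explicit saddle point, which gives
    the two minima exactly and shows that they are attained
    ([saddle_is_min]).  The point [x = e / 2] is a maximizer in both, as the
    symmetry of [C] and the concavity of the objective suggest; the optimal scaling is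
    [gamma = 1] for [I] and [gamma = 4/3] for [C].

    - For [I] the value is 0: at [gamma = 1] the matrix of the objective is [I]
      for every [x], and at [x = e / 2] the claim is [((1 + gamma) / 2)^2 >=
      gamma] ([linx_1_is_min]).
    - For [C] at [x = e / 2], the identity [C^2 = 3/2 C] leaves an explicit
      determinant ([det_linx_triple_half]), and minimizing it over [gamma] is
      the inequality [(1 + u)^4 >= 256/27 u^3] for [u = 9/4 gamma], with
      equality at [u = 3].
    - For [C] at [gamma = 4/3], let [A(x)] be the matrix of the objective and
      let [S = 2 I - P], so that [S A(e/2) S = 2 I].  Then [S A(x) S] is
      positive semidefinite of trace [2 n] for every feasible [x]; its
      determinant is at most [2^n] by Hadamard's inequality and the inequality between the
      arithmetic and geometric means, which is the bound
      [det A(x) <= det A(e/2)] ([det_linx_triple_le]).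

    The gap is therefore [n / 12 * ln (27 / 16)], about [0.0436 n]. *)

Local Open Scope classical_set_scope.
Local Open Scope ring_scope.

(** * Positive semidefinite matrices and Hadamard's inequality *)

Lemma psdmx_congr (R : realType) (m n : nat) (A : 'M[R]_n) (L : 'M[R]_(m, n)) :
  psdmx A -> psdmx (L *m A *m L^T).
Proof.
move=> [symA posA]; split=> [|v].
  by rewrite !trmx_mul trmxK symA mulmxA.
by have := posA (L^T *m v); rewrite trmx_mul trmxK !mulmxA.
Qed.

Lemma psdmxD (R : realType) (n : nat) (A B : 'M[R]_n) :
  psdmx A -> psdmx B -> psdmx (A + B).
Proof.
move=> [symA posA] [symB posB]; split=> [|v]; first by rewrite linearD /= symA symB.
by rewrite mulmxDr mulmxDl mxE addr_ge0.
Qed.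

Lemma psdmxZ (R : realType) (n : nat) (a : R) (A : 'M[R]_n) :
  0 <= a -> psdmx A -> psdmx (a *: A).
Proof.
move=> a0 [symA posA]; split=> [|v]; first by rewrite linearZ /= symA.
by rewrite -scalemxAr -scalemxAl mxE mulr_ge0.
Qed.

Lemma psdmx_diag (R : realType) (n : nat) (d : 'rV[R]_n) :
  (forall i, 0 <= d 0 i) -> psdmx (diag_mx d).
Proof.
move=> d0; split=> [|v]; first by rewrite tr_diag_mx.
rewrite mul_mx_diag mxE sumr_ge0 // => i _.
by rewrite !mxE -mulrA mulrCA -expr2 mulr_ge0 ?sqr_ge0.
Qed.

Lemma delta_form (R : realType) (n : nat) (A : 'M[R]_n) (i j : 'I_n) :
  (delta_mx i 0 : 'cV_n)^T *m A *m (delta_mx j 0 : 'cV_n) = (A i j)%:M.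
Proof. by rewrite trmx_delta -rowE -colE [LHS]mx11_scalar !mxE. Qed.

Lemma psdmx_diag_ge0 (R : realType) (n : nat) (A : 'M[R]_n) (i : 'I_n) :
  psdmx A -> 0 <= A i i.
Proof. by case=> _ /(_ (delta_mx i 0)); rewrite delta_form mxE. Qed.

(** Otherwise the quadratic form at [t e_i + e_j], which is then affine and
    nonconstant in [t], would take negative values. *)
Lemma psdmx_diag_eq0 (R : realType) (n : nat) (A : 'M[R]_n) (i j : 'I_n) :
  psdmx A -> A i i = 0 -> A i j = 0.
Proof.
move=> [symA posA] Aii0; apply/eqP; apply: contraT => Aij0.
have Aji : A j i = A i j by rewrite -[in RHS]symA mxE.
pose t := - (A j j + 1) / (2 * A i j).
have := posA (t *: delta_mx i 0 + delta_mx j 0).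
rewrite [(_ + _)^T]raddfD /= [(_ *: _)^T]linearZ /= mulmxDr !mulmxDl.
rewrite -!scalemxAr -!scalemxAl.
rewrite !delta_form Aii0 Aji !mxE eqxx !mulr1n.
suff -> : t * (t * 0) + t * A i j + (t * A i j + A j j) = -1 by rewrite oppr_ge0 ler10.
by rewrite /t; field.
Qed.

(** Hadamard's inequality.  One step of symmetric Gaussian elimination
    replaces the trailing block by a Schur complement, which is still positive
    semidefinite and has a smaller diagonal. *)
Lemma psdmx_det_le_prod (R : realType) (n : nat) (A : 'M[R]_n) :
  psdmx A -> \det A <= \prod_i A i i.
Proof.
elim: n A => [|n IHn] A psdA; first by rewrite det_mx00 big_ord0.
have [a0|a_neq0] := eqVneq (A 0 0) 0.
  rewrite (expand_det_row _ 0) big1 => [|j _]; last by rewrite psdmx_diag_eq0 ?mul0r.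
  by apply: prodr_ge0 => i _; exact: psdmx_diag_ge0.
have a_gt0 : 0 < A 0 0 by rewrite lt_def a_neq0 psdmx_diag_ge0.
pose v : 'cV[R]_n := dlsubmx (A : 'M[R]_(1 + n)).
pose D : 'M[R]_n := drsubmx (A : 'M[R]_(1 + n)).
pose L : 'M[R]_(1 + n) := block_mx 1%:M 0 (- (A 0 0)^-1 *: v) 1%:M.
pose Schur := D - (A 0 0)^-1 *: (v *m v^T).
have AE : A = block_mx (A 0 0)%:M v^T v D :> 'M[R]_(1 + n).
  rewrite -[LHS](@submxK _ 1 n 1 n) [ulsubmx _]mx11_scalar; congr block_mx.
    by congr (_%:M); rewrite !mxE; congr (A _ _); exact: val_inj.
  by rewrite /v trmx_dlsub psdA.1.
have LAL : L *m (A : 'M[R]_(1 + n)) *m L^T = block_mx (A 0 0)%:M 0 0 Schur.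
  rewrite [in LHS]AE /L tr_block_mx !mulmx_block !trmx1 !trmx0 !mul1mx !mul0mx.
  rewrite !mulmx1 !mulmx0 !addr0 linearZ /= mul_mx_scalar scalerA.
  rewrite mulrN divff // scaleN1r addNr mul0mx add0r.
  by rewrite -scalemxAr mul_scalar_mx scalerA mulNr mulVf // !scaleN1r addrC subrr
     -scalemxAl scaleNr addrC.
have detA : \det A = A 0 0 * \det Schur.
  have := congr1 (fun M : 'M[R]_(1 + n) => \det M) LAL.
  rewrite !det_mulmx det_tr det_lblock !det1 !mul1r mulr1 => ->.
  by rewrite det_lblock det_scalar1.
have psdSchur : psdmx Schur.
  have -> : Schur = row_mx 0 1%:M *m (L *m (A : 'M[R]_(1 + n)) *m L^T)
                    *m (row_mx 0 1%:M : 'M[R]_(n, 1 + n))^T.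
    rewrite LAL tr_row_mx trmx0 trmx1 mul_row_block mul_row_col.
    by rewrite !mul0mx !mulmx0 !mulmx1 !mul1mx !add0r.
  by apply: psdmx_congr; apply: (@psdmx_congr R (1 + n) (1 + n)).
rewrite detA big_ord_recl ler_wpM2l ?(ltW a_gt0) //.
apply: le_trans (IHn _ psdSchur) _.
apply: ler_prod => i _; rewrite psdmx_diag_ge0 //= !mxE big_ord1 !mxE.
rewrite (_ : rshift 1 i = lift 0 i); last exact: val_inj.
by rewrite lerBlDr lerDl -expr2 mulr_ge0 ?sqr_ge0 // invr_ge0 ltW.
Qed.

Lemma psdmx_det_le_trace (R : realType) (n : nat) (A : 'M[R]_n) :
  psdmx A -> \det A <= (\tr A / n%:R) ^+ n.
Proof.
move=> psdA; apply: le_trans (psdmx_det_le_prod _ _ _ psdA) _.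
have := @leif_AGM R _ [pred i : 'I_n | true] (fun i : 'I_n => A i i).
rewrite /= cardT size_enum_ord => -[] // i _; exact: psdmx_diag_ge0.
Qed.

(** Sylvester's identity: both sides are the determinant of the block matrix
    with blocks [1, -A, B, 1], eliminated from either corner. *)
Lemma sylvester_det (R : realType) (m n : nat) (A : 'M[R]_(m, n)) (B : 'M[R]_(n, m)) :
  \det (1%:M + A *m B) = \det (1%:M + B *m A).
Proof.
pose M := block_mx 1%:M (- A) B 1%:M.
have E1 : M = block_mx (1%:M + A *m B) (- A) 0 1%:M *m block_mx 1%:M 0 B 1%:M.
  by rewrite mulmx_block !mulmx1 !mulmx0 !mul1mx !add0r mulNmx addrK.
have E2 : M = block_mx 1%:M 0 B 1%:M *m block_mx 1%:M (- A) 0 (1%:M + B *m A).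
  by rewrite mulmx_block !mulmx1 !mulmx0 !mul1mx ?mul0mx !addr0 mulmxN addrCA addNr addr0.
have := congr1 determinant E1; rewrite E2 !det_mulmx !det_lblock !det_ublock.
by rewrite !det1 !mul1r !mulr1.
Qed.

(** * Saddle points of the linx objective *)

Lemma psdmx_linx_mx (R : realType) (n s : nat) (C : 'M[R]_n) (g : R) (x : 'rV[R]_n) :
  C^T = C -> 0 <= g -> Pset n s x -> psdmx (linx_mx C g x).
Proof.
move=> symC g0 [_ x01]; apply: psdmxD.
  apply: psdmxZ => //; rewrite -{2}symC; apply: psdmx_congr.
  by apply: psdmx_diag => i; case/andP: (x01 i).
by apply: psdmx_diag => i; rewrite !mxE subr_ge0; case/andP: (x01 i).
Qed.

Lemma Pset_half (R : realType) (n s : nat) :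
  n = (s + s)%N -> @Pset R n s (const_mx 2^-1).
Proof.
move=> ->; split=> [|i]; last by rewrite mxE; lra.
under eq_bigr do rewrite mxE.
by rewrite sumr_const card_ord -[LHS]mulr_natr natrD; lra.
Qed.

Lemma linx_mx_half (R : realType) (n : nat) (C : 'M[R]_n) (g : R) :
  linx_mx C g (const_mx 2^-1) = 2^-1 *: (1%:M + g *: (C *m C)).
Proof.
rewrite /linx_mx -(raddfB (@const_mx R 1 n)) !diag_const_mx mul_mx_scalar -scalemxAl.
rewrite scalerDr !scalerA mulrC addrC -scalemx1; congr (_ *: _ + _); lra.
Qed.

(** The upper bounds at [g0] and the lower bounds at [x0] meet, so that [g0]
    minimizes [linx].  They are stated for determinants, with the scaling term
    [s * ln g] of the objective moved to the other side as [g ^+ s], to keep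
    logarithms out of the applications. *)
Lemma saddle_is_min (R : realType) (n s : nat) (C : 'M[R]_n) (K g0 : R)
    (x0 : 'rV[R]_n) :
  0 < K -> 0 < g0 -> Pset n s x0 ->
  (forall x, Pset n s x -> \det (linx_mx C g0 x) <= K * g0 ^+ s) ->
  (forall g, 0 < g -> K * g ^+ s <= \det (linx_mx C g x0)) ->
  is_min [set linx C s g | g in [set g : R | 0 < g]] (2^-1 * ln K)%:E.
Proof.
move=> K0 g00 Px0 max_x0 min_g0.
have valE g : 0 < g ->
    (2^-1 * ln K)%:E =
    ((2^-1)%:E * (lne (K * g ^+ s)%:E - (s%:R * ln g)%:E))%E.
  move=> g_gt0; have gs0 : 0 < g ^+ s by rewrite exprn_gt0.
  rewrite lne_EFin ?mulr_gt0 // lnM // lnXn // -EFinB -EFinM.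
  by rewrite mulr_natl addrK.
have half0 : (0 <= (2^-1 : R)%:E)%E by rewrite lee_fin.
have lower g : 0 < g -> ((2^-1 * ln K)%:E <= linx C s g)%E.
  move=> g_gt0; apply: (@le_trans _ _ (linx_obj C s g x0)); last first.
    by apply: ereal_sup_ubound; exists x0.
  rewrite (valE g) //; apply: lee_wpmul2l => //; apply: leeD2r.
  by apply: lne_homo; rewrite lee_fin min_g0.
split=> [|_ [g /= g_gt0 <-]]; last exact: lower.
exists g0 => //; apply/eqP; rewrite eq_le lower // andbT.
apply: ge_ereal_sup => _ [x Px <-].
rewrite (valE g0) //; apply: lee_wpmul2l => //; apply: leeD2r.
by apply: lne_homo; rewrite lee_fin max_x0.
Qed.

Lemma linx_1_is_min (R : realType) (n s : nat) :
  n = (s + s)%N ->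
  is_min [set linx (1%:M : 'M[R]_n) s g | g in [set g : R | 0 < g]] 0%E.
Proof.
move=> nE; have -> : (0 : \bar R)%E = (2^-1 * ln 1)%:E by rewrite ln1 mulr0.
apply: (@saddle_is_min _ _ _ _ _ 1 (const_mx 2^-1)) => //; first exact: Pset_half.
  move=> x _; rewrite /linx_mx mul1mx mulmx1 scale1r -raddfD /= addrC subrK.
  by rewrite diag_const_mx det1 expr1n mulr1.
move=> g g0; have sq := sqr_ge0 (1 - g).
rewrite linx_mx_half mulmx1 scalemx1 -raddfD /= detZ det_scalar nE.
rewrite mul1r -exprMn exprD -exprMn lerXn2r // ?nnegrE; nra.
Qed.

(** * Centred triples *)

(** The incidence matrix of the triples: when [n = 3 m], the residue classes
    modulo [m] split the [n] indices into [m] classes of size 3.  Residues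
    rather than quotients make the matrix the row of blocks [1 1 1]. *)
Definition residue_mx (R : realType) (m n : nat) : 'M[R]_(m, n) :=
  \matrix_(k < m, i < n) ((i %% m)%N == k)%:R.

(** This is [3/2] times the projection [1 - W^T W / 3], for [W] the incidence
    matrix: block diagonal up to a permutation of the indices, with 3 by 3
    blocks that have 1 on and [-1/2] off the diagonal. *)
Definition triple_mx (R : realType) (m n : nat) : 'M[R]_n :=
  (3 / 2)%:M - 2^-1 *: ((residue_mx R m n)^T *m residue_mx R m n).

Lemma residue_mx_mul_tr (R : realType) (m n : nat) :
  n = (m + m + m)%N -> residue_mx R m n *m (residue_mx R m n)^T = 3%:M.
Proof.
move=> ->; apply/matrixP=> k l; rewrite !mxE.
under eq_bigr do rewrite !mxE.
have sumE : \sum_(i < m) (i == k)%:R * (i == l)%:R = (k == l)%:R :> R.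
  rewrite (bigD1 k) //= eqxx mul1r big1 ?addr0 // => i /negPf.
  by rewrite -val_eqE /= => ->; rewrite mul0r.
have modE (i : 'I_m) : ((i %% m)%N = i) by rewrite modn_small.
rewrite !big_split_ord /=.
under eq_bigr do rewrite modE.
under [X in _ + X + _]eq_bigr do rewrite modnDl modE.
under [X in _ + X]eq_bigr do rewrite -addnA !modnDl modE.
rewrite !sumE; case: (k == l) => /=; rewrite ?mulr1n ?mulr0n; lra.
Qed.

Lemma residue_mx_tr_mul_diag (R : realType) (m n : nat) (i : 'I_n) :
  (0 < m)%N -> ((residue_mx R m n)^T *m residue_mx R m n) i i = 1.
Proof.
move=> m0; rewrite mxE (bigD1 (Ordinal (ltn_pmod i m0))) //= !mxE eqxx mulr1.
rewrite big1 ?addr0 // => k; rewrite -val_eqE /= => /negPf kF.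
by rewrite !mxE eq_sym kF mul0r.
Qed.

Lemma triple_mx_sym (R : realType) (m n : nat) :
  (triple_mx R m n)^T = triple_mx R m n.
Proof.
by rewrite [LHS]raddfB /= tr_scalar_mx linearZ /= trmx_mul trmxK.
Qed.

Lemma triple_mx_diag (R : realType) (m n : nat) (i : 'I_n) :
  (0 < m)%N -> triple_mx R m n i i = 1.
Proof.
move=> m0; rewrite !(residue_mx_tr_mul_diag, mxE) // eqxx mulr1n; lra.
Qed.

Lemma triple_mx_sqr (R : realType) (m n : nat) :
  n = (m + m + m)%N ->
  triple_mx R m n *m triple_mx R m n = (3 / 2) *: triple_mx R m n.
Proof.
move=> nE; rewrite /triple_mx; set W := residue_mx R m n.
have WW : W^T *m W *m (W^T *m W) = 3 *: (W^T *m W).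
  by rewrite mulmxA -(mulmxA W^T) residue_mx_mul_tr // mul_mx_scalar scalemxAl.
rewrite mulmxBl mul_scalar_mx mulmxBr -!scalemxAl -!scalemxAr WW.
rewrite mul_mx_scalar !scalerBr !scalerA.
move: (W^T *m W) => Q.
apply/matrixP=> i j; rewrite !mxE -[_ *+ (i == j)]mulr_natr; lra.
Qed.

(** [W^T W] has eigenvalue 3 with multiplicity [m] and 0 with multiplicity
    [2 m]; Sylvester's identity reads this off [W W^T = 3]. *)
Lemma det_scalar_residue (R : realType) (m n : nat) (a b : R) :
  n = (m + m + m)%N -> a != 0 ->
  \det (a%:M + b *: ((residue_mx R m n)^T *m residue_mx R m n)) =
  (a ^+ 2 * (a + 3 * b)) ^+ m.
Proof.
move=> nE a0; set W := residue_mx R m n.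
have -> : a%:M + b *: (W^T *m W) = a *: (1%:M + ((b / a) *: W^T) *m W).
  by rewrite scalerDr scalemx1 -scalemxAl scalerA mulrC divfK.
rewrite detZ sylvester_det -scalemxAr residue_mx_mul_tr // scale_scalar_mx.
rewrite -raddfD /= det_scalar nE -addnA !exprD !exprMn.
by rewrite -!exprMn; congr (_ ^+ _); field.
Qed.

Lemma mxtrace_mul_diag (R : realType) (n : nat) (A : 'M[R]_n) (d : 'rV[R]_n) :
  \tr (A *m diag_mx d) = \sum_i A i i * d 0 i.
Proof. by apply: eq_bigr => i _; rewrite mul_mx_diag mxE. Qed.

(** At the scaling [4 / 3], no [x] does better than [e / 2].  Conjugation by
    [S], which is the inverse square root of the matrix at [e / 2] up to a
    scalar, turns the first-order expansion of the determinant at [e / 2] into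
    a trace.  As [C] and [S] commute and have constant diagonals, this trace
    depends on [x] only through the sum of its entries, and the two
    contributions of that sum cancel. *)
Lemma det_linx_triple_le (R : realType) (m n s : nat) (x : 'rV[R]_n) :
  (0 < m)%N -> n = (m + m + m)%N -> Pset n s x ->
  \det (linx_mx (triple_mx R m n) (4 / 3) x) <= 2 ^+ m.
Proof.
move=> m0 nE Px; set C := triple_mx R m n; set A := linx_mx _ _ _.
(* S has eigenvalue 1 on the range of C and 2 on its kernel. *)
pose S : 'M[R]_n := 2%:M - (2 / 3) *: C.
have symC : C^T = C by exact: triple_mx_sym.
have CC : C *m C = (3 / 2) *: C by exact: triple_mx_sqr.
have symS : S^T = S by rewrite [LHS]raddfB /= tr_scalar_mx linearZ /= symC.
have detS : \det S = 2 ^+ m.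
  have -> : S = 1%:M + 3^-1 *: ((residue_mx R m n)^T *m residue_mx R m n).
    rewrite /S /C /triple_mx; apply/matrixP=> i j.
    by rewrite !mxE; case: (i == j); rewrite ?mulr1n ?mulr0n; lra.
  rewrite det_scalar_residue ?oner_neq0 //; congr (_ ^+ _); lra.
have CS : C *m S = C.
  rewrite mulmxBr mul_mx_scalar -scalemxAr CC scalerA -scalerBl.
  by rewrite -[RHS]scale1r; congr (_ *: _); lra.
have SC : S *m C = C by rewrite -symS -{1}symC -trmx_mul CS symC.
have SS : S *m S = 4%:M - 2 *: C.
  rewrite {1}/S mulmxBl mul_scalar_mx -scalemxAl CS /S scalerBr scale_scalar_mx.
  apply/matrixP=> i j; rewrite !mxE; case: (i == j); rewrite ?mulr1n ?mulr0n; lra.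
have Cii i : C i i = 1 by exact: triple_mx_diag.
clearbody S C.
have psdSAS : psdmx (S *m A *m S).
  rewrite -{2}symS; apply: psdmx_congr; apply: (@psdmx_linx_mx _ _ s) => //.
have trSAS : \tr (S *m A *m S) = n%:R * 2.
  have -> : S *m A *m S = (4 / 3) *: (C *m diag_mx x *m C)
                          + S *m diag_mx (const_mx 1 - x) *m S.
    rewrite /A /linx_mx -/C mulmxDr mulmxDl -scalemxAr -scalemxAl.
    by rewrite !mulmxA SC -!mulmxA CS.
  rewrite mxtraceD mxtraceZ mxtrace_mulC mulmxA CC -scalemxAl mxtraceZ.
  rewrite [X in _ + X]mxtrace_mulC mulmxA SS !mxtrace_mul_diag.
  under eq_bigr do rewrite Cii mul1r.
  rewrite Px.1.
  under eq_bigr => i _.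
    rewrite !mxE Cii eqxx mulr1n mulr1.
    rewrite (_ : (4 - 2) * (1 - x 0 i) = 2 - 2 * x 0 i); last by ring.
    over.
  rewrite sumrB -mulr_sumr Px.1 sumr_const card_ord -mulr_natr; lra.
have := psdmx_det_le_trace _ _ _ psdSAS.
have n0 : n%:R != 0 :> R by rewrite pnatr_eq0 nE -lt0n !addn_gt0 m0.
rewrite !det_mulmx detS trSAS [n%:R * 2]mulrC mulfK //.
by rewrite [in leRHS]nE !exprD ler_pM2r ?exprn_gt0 // ler_pM2l ?exprn_gt0.
Qed.

Lemma det_linx_triple_half (R : realType) (m n : nat) (g : R) :
  n = (m + m + m)%N -> 0 < g ->
  \det (linx_mx (triple_mx R m n) g (const_mx 2^-1)) =
  (8^-1 * (1 + 9 / 4 * g) ^+ 2) ^+ m.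
Proof.
move=> nE g0; rewrite linx_mx_half triple_mx_sqr // detZ.
have -> : 1%:M + g *: (3 / 2 *: triple_mx R m n) = (1 + 9 / 4 * g)%:M
    + (- (3 / 4 * g)) *: ((residue_mx R m n)^T *m residue_mx R m n).
  by apply/matrixP=> i j; rewrite !mxE; case: (i == j); rewrite ?mulr1n ?mulr0n; lra.
rewrite det_scalar_residue //; last by rewrite gt_eqF //; lra.
rewrite nE !exprD -!exprMn; congr (_ ^+ _); by field.
Qed.

Lemma linx_triple_is_min (R : realType) (k m n s : nat) :
  (0 < k)%N -> m = (k + k)%N -> n = (m + m + m)%N -> s = (k + k + k)%N ->
  is_min [set linx (triple_mx R m n) s g | g in [set g : R | 0 < g]]
         (2^-1 * ln ((27 / 16) ^+ k))%:E.
Proof.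
move=> k0 mE nE sE.
apply: (@saddle_is_min _ _ _ _ _ (4 / 3) (const_mx 2^-1)).
- by rewrite exprn_gt0 //; lra.
- lra.
- by apply: Pset_half; rewrite nE mE sE; lia.
- move=> x Px; have m0 : (0 < m)%N by rewrite mE addn_gt0 k0.
  apply: le_trans (det_linx_triple_le _ _ _ _ _ m0 nE Px) _.
  by rewrite mE sE !exprD -!exprMn lerXn2r ?nnegrE //; lra.
move=> g g0; rewrite det_linx_triple_half // mE sE !exprD -!exprMn.
have g3 : 0 <= g ^+ 3 by rewrite exprn_ge0 // ltW.
(* This product is (1 + u) ^ 4 - 256 / 27 * u ^ 3 at u = 9 / 4 * g. *)
have sq : 0 <= (9 / 4 * g - 3) ^+ 2 * ((9 / 4 * g) ^+ 2 + 14 / 27 * (9 / 4 * g) + 9^-1).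
  by rewrite mulr_ge0 ?sqr_ge0 // !addr_ge0 ?sqr_ge0 // mulr_ge0 //; lra.
rewrite lerXn2r ?nnegrE //; nra.
Qed.

Lemma hadamard_triple_1 (R : realType) (m n : nat) :
  (0 < m)%N -> hadamard (triple_mx R m n) 1%:M = 1%:M.
Proof.
move=> m0; apply/matrixP=> i j; rewrite [LHS]mxE [1%:M i j]mxE.
by case: eqVneq => [->|_]; rewrite ?triple_mx_diag ?mul1r ?mulr0.
Qed.

(** * The gap *)

Theorem theorem4p1 (R : realType) :
  exists (I : set nat) (C : forall n : nat, 'M[R]_n) (b : R),
    [/\ infinite_set I,
        forall n, I n -> (0 < n)%N && ~~ odd n,
        forall n, I n -> psdmx (C n),
        0 < b /\ 24 / 10 ^+ 3 + 36 / 10 ^+ 6 <= b &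
        forall n, I n ->
          exists m1 m2 : \bar R,
            [/\ is_min [set linx (C n) n./2 g | g in [set g : R | 0 < g]] m1,
                is_min [set linx_masked (C n) n./2 1%:M g
                       | g in [set g : R | 0 < g]] m2 &
                ((b * n%:R)%:E <= m1 - m2)%E]].
Proof.
exists [set n | exists k, n = (6 * k.+1)%N], (fun n => triple_mx R (n %/ 3) n),
  (ln (27 / 16) / 12).
have divE k : (6 * k.+1 %/ 3 = k.+1 + k.+1)%N by lia.
have halfE k : ((6 * k.+1)./2 = k.+1 + k.+1 + k.+1)%N by lia.
have bge : 24 / 10 ^+ 3 + 36 / 10 ^+ 6 <= ln (27 / 16) / 12 :> R.
  (* This is ln (16 / 27) <= 16 / 27 - 1, so the constant is at least 11 / 324. *)
  have : ln (1 - 11 / 27) <= - (11 / 27) :> R by apply: le_ln1Dx; lra.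
  rewrite (_ : 1 - 11 / 27 = (27 / 16)^-1); last by field.
  by rewrite lnV ?posrE; lra.
split.
- move=> /(finite_image (fun n => (n %/ 6).-1)) finI; apply: infinite_nat.
  apply: sub_finite_set finI => k _; exists (6 * k.+1)%N; first by exists k.
  by rewrite mulKn.
- by move=> _ [k ->]; rewrite oddM.
- move=> _ [k ->]; rewrite divE; set C := triple_mx _ _ _.
  (* As C ^ 2 = 3 / 2 * C, the matrix C is a multiple of a Gram matrix. *)
  have -> : C = (2 / 3) *: (C *m 1%:M *m C^T).
    rewrite mulmx1 triple_mx_sym triple_mx_sqr; last by lia.
    by rewrite scalerA -[LHS]scale1r; congr (_ *: _); lra.
  apply: psdmxZ; first lra.
  by apply: psdmx_congr; rewrite -diag_const_mx; apply: psdmx_diag => i; rewrite mxE.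
- by split=> //; apply: lt_le_trans bge; lra.
move=> _ [k ->]; rewrite divE halfE.
exists (2^-1 * ln ((27 / 16) ^+ k.+1))%:E, 0%E; split.
- by apply: linx_triple_is_min => //; lia.
- rewrite /linx_masked hadamard_triple_1 //.
  by apply: linx_1_is_min; lia.
rewrite sube0 lee_fin lnXn; last by lra.
by rewrite -[ln _ *+ _]mulr_natr natrM; lra.
Qed.
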